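(* Let $G=(V,E,T,c)$ be a planar $k$-terminal network with $\gamma=\gamma(G)$, with faces $f_1,\dots,f_\gamma$ and numbers $k_1,\dots,k_\gamma$ as in the context. Then $$|\mathcal{T}_e(G)|\le 2^{2\gamma}\prod_{i=1}^{\gamma}k_i^2\le (2k/\gamma)^{2\gamma}.$$
   Context: A $k$-terminal network $G=(V,E,T,c)$ is a finite connected undirected graph $(V,E)$ with edge weights $c:E\to\mathbb{R}_{>0}$ and a set $T\subseteq V$ of $|T|=k$ terminals. For $W\subseteq V$ let $\delta(W)$ be the set of edges with exactly one endpoint in $W$. For $S\subset T$ with $S\neq\emptyset,T$, the minimum-weight cutset $\delta(W)$ over all $W$ with $W\cap T\in\{S,T\setminus S\}$ is assumed unique and denoted $E_S$. $CC(F)$ denotes the set of connected components of $(V,E\setminus F)$, and $\mathcal{T}_e(G)=\{S\subset T:\ S\neq\emptyset,T,\ |CC(E_S)|=2\}$. $G$ is planar with a fixed embedding; $\gamma(G)$ is the minimum number of faces whose boundaries together contain all terminals. Fix faces $f_1,\dots,f_\gamma$ achieving this, partition $T=T_1\sqcup\dots\sqcup T_\gamma$ with every terminal of $T_i$ on the boundary of $f_i$ (ties broken arbitrarily), and let $k_i=|T_i|$, so $\sum_i k_i=k$. *)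

(* Defs.v *)
(* Planar k-terminal networks, encoded by combinatorial maps
   (rotation systems): darts D, fixed-point-free involution alpha (the two
   half-edges of an edge), rotation sigma around vertices, and vtx : D -> V
   the tail vertex of a dart. Faces are the orbits of phi = sigma o alpha;
   planarity (genus 0) is Euler's formula for the connected map. *)
From HB Require Import structures.
From mathcomp Require Import all_boot all_order all_algebra all_fingroup.
Set Implicit Arguments. Unset Strict Implicit. Unset Printing Implicit Defensive.
Import Order.TTheory GRing.Theory Num.Theory.

Section Network.
Variables (V D : finType) (alpha sigma : {perm D}) (vtx : D -> V).

Definition is_map : Prop :=
  [/\ forall d, alpha d != d,
      forall d, alpha (alpha d) = d &
      forall d d', (vtx d == vtx d') = fconnect sigma d d'].

(* adjacency in (V, E \ F), F a set of darts (closed under alpha) *)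
Definition adj (F : {set D}) : rel V :=
  fun u v => [exists d, [&& d \notin F, vtx d == u & vtx (alpha d) == v]].

Definition connected_graph : Prop := forall u v : V, connect (adj set0) u v.

Definition ncomp (F : {set D}) : nat := n_comp (adj F) predT.

Definition face_perm : {perm D} := (alpha * sigma)%g.

Definition nfaces : nat := fcard face_perm predT.

(* Euler formula |V| - |E| + |F| = 2, with |E| = |D|/2 *)
Definition genus0 : Prop := (#|V| + nfaces = #|D| %/ 2 + 2)%N.

Definition face_verts (d : D) : {set V} :=
  [set vtx x | x in [pred x | fconnect face_perm d x]].

(* the faces f_0, ..., f_{m-1} (given by representative darts) together contain T *)
Definition covers (T : {set V}) (m : nat) (f : 'I_m -> D) : Prop :=
  forall t, t \in T -> exists i, t \in face_verts (f i).

Variables (R : realFieldType) (c : D -> R).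
Local Open Scope ring_scope.

Definition weights_ok : Prop := (forall d, 0 < c d) /\ (forall d, c (alpha d) = c d).

(* weight of an edge set given as an alpha-closed dart set: each edge counted once *)
Definition weight (F : {set D}) : R := (\sum_(d in F) c d) / 2%:R.

Definition cut (W : {set V}) : {set D} :=
  [set d | (vtx d \in W) != (vtx (alpha d) \in W)].

Definition separates (T S W : {set V}) : bool :=
  (W :&: T == S) || (W :&: T == T :\: S).

Definition is_min_cut (T S : {set V}) (F : {set D}) : bool :=
  [exists W : {set V}, separates T S W && (F == cut W)] &&
  [forall W : {set V}, separates T S W ==> (weight F <= weight (cut W))].

Definition unique_min_cuts (T : {set V}) : Prop :=
  forall S : {set V}, S \subset T -> S != set0 -> S != T ->
  forall F1 F2, is_min_cut T S F1 -> is_min_cut T S F2 -> F1 = F2.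

Definition Te (T : {set V}) : {set {set V}} :=
  [set S : {set V} | [&& S \subset T, S != set0, S != T &
     [exists F : {set D}, is_min_cut T S F && (ncomp F == 2%N)]]].

End Network.

(* Main.v *)
(* If the minimum cutset E_S has two components, they are W and its complement
   for some W with S = T :&: W (up to complementing W).  By Euler's formula the
   coboundaries of vertex functions are exactly the edge functions whose signed
   sum around every face vanishes; since both sides of the cut are connected,
   those supported on the cut form a line.  Counting unknowns (cut edges) against
   equations (faces met by the cut) shows that the cut meets at least as many
   faces as it has edges.  Each such face contains at least two cut darts, hence
   exactly two: walking around a face, membership in W changes at most twice, and
   S is a cyclic interval on each T_i.  Such an interval is encoded by two bits
   and two elements of T_i, giving at most 4 k_i^2 choices.  The second inequality
   is AM-GM, all k_i being positive by minimality of gamma. *)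
Require Import Defs.
From HB Require Import structures.
From mathcomp Require Import all_boot all_order all_algebra all_fingroup.
Set Implicit Arguments. Unset Strict Implicit. Unset Printing Implicit Defensive.
Import Order.TTheory GRing.Theory Num.Theory.
Local Open Scope ring_scope.

(** * Linear systems indexed by finite types *)

Definition fun_mx {K : fieldType} {I J : finType} (g : I -> J -> K) :
  'M[K]_(#|I|, #|J|) := \matrix_(i, j) g (enum_val i) (enum_val j).

Lemma row_mul_fun_mx {K : fieldType} {I J : finType} (g : I -> J -> K)
    (u : 'rV_#|I|) (j : J) :
  (u *m fun_mx g) 0 (enum_rank j) = \sum_i u 0 (enum_rank i) * g i j.
Proof.
rewrite mxE (reindex (@enum_rank I)) /=; last exact: onW_bij (enum_rank_bij _).
by apply: eq_bigr => i _; rewrite mxE !enum_rankK.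
Qed.

Lemma mul_fun_mx_eq0 {K : fieldType} {I J : finType} (g : I -> J -> K)
    (u : 'rV_#|I|) :
  u *m fun_mx g = 0 <->
  forall j, \sum_i u 0 (enum_rank i) * g i j = 0.
Proof.
split=> [u0 j|u0]; first by rewrite -row_mul_fun_mx u0 mxE.
by apply/rowP=> j; rewrite -(enum_valK j) row_mul_fun_mx u0 mxE.
Qed.

(** The left kernel contains only constant vectors, so its dimension is at most one; rank-nullity
    does the rest. *)
Lemma card_le_rank_fun_mx {K : fieldType} {I J : finType} (g : I -> J -> K) :
  (forall z : I -> K, (forall j, \sum_i z i * g i j = 0) ->
     forall i i', z i = z i') ->
  (#|I| <= (\rank (fun_mx g)).+1)%N.
Proof.
move=> zC.
have : (\rank (kermx (fun_mx g)) <= 1)%N.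
  apply: leq_trans (rank_leq_row (const_mx 1 : 'rV[K]_#|I|)).
  apply: mxrankS; apply/row_subP=> k; apply/sub_rVP.
  have /mul_fun_mx_eq0 /zC z_const : row k (kermx (fun_mx g)) *m fun_mx g = 0.
    by rewrite -row_mul mulmx_ker row0.
  have [i0 _|noI] := pickP (xpredT : pred 'I_#|I|); last first.
    by exists 0; apply/rowP=> i; have := noI i.
  exists (row k (kermx (fun_mx g)) 0 i0); apply/rowP=> i.
  rewrite !mxE mulr1; have := z_const (enum_val i) (enum_val i0).
  by rewrite !enum_valK !mxE.
by rewrite mxrank_ker leq_subLR addn1.
Qed.

(** The block of [g] on [A] and [H] has more rows than columns, hence a nonzero left kernel vector,
    which is extended by zero outside [A]. *)
Lemma underdetermined_system {K : fieldType} {I J : finType}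
    (A : {set I}) (H : {set J}) (g : I -> J -> K) :
  (#|H| < #|A|)%N ->
  exists z : I -> K, [/\ forall i, i \notin A -> z i = 0,
    exists i, z i != 0 & forall j, j \in H -> \sum_i z i * g i j = 0].
Proof.
move=> ltHA.
pose M : 'M[K]_(#|A|, #|H|) := \matrix_(i, j) g (enum_val i) (enum_val j).
have : kermx M != 0.
  by rewrite -mxrank_eq0 mxrank_ker subn_eq0 -ltnNge (leq_ltn_trans (rank_leq_col M)).
case/rowV0Pn=> v /sub_kermxP vM /eqP v_neq0.
pose z i := if [pick k | enum_val k == i] is Some k then v 0 k else 0.
have zE k : z (enum_val k) = v 0 k.
  rewrite /z; case: pickP => [k' /eqP /enum_val_inj -> //|/(_ k)].
  by rewrite eqxx.
exists z; split.
- move=> i iA; rewrite /z; case: pickP => // k /eqP ki.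
  by rewrite -ki enum_valP in iA.
- have [k vk|v0] := pickP (fun k => v 0 k != 0).
    by exists (enum_val k); rewrite zE.
  by case: v_neq0; apply/rowP=> k; rewrite mxE; apply/eqP; rewrite -[_ == _]negbK v0.
- move=> j jH; rewrite (bigID (mem A)) /= [X in _ + X]big1 ?addr0; last first.
    move=> i iA; rewrite /z; case: pickP => [k /eqP ki|_]; last by rewrite mul0r.
    by rewrite -ki enum_valP in iA.
  have /rowP /(_ (enum_rank_in jH j)) := vM; rewrite !mxE; apply: etrans.
  rewrite big_enum_val /=; apply: eq_bigr => k _.
  by rewrite zE !mxE enum_rankK_in.
Qed.

(** * Cuts and cycles of a graph and its dual *)

Section Duality.
Variables (K : fieldType) (V E F : finType) (a b : E -> V) (l r : E -> F).

(** Signed incidence matrices of the graph ([delta]) and of its dual ([bd]): [a e], [b e] are the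
    ends of [e], and [l e], [r e] the faces on its two sides. *)
Let delta (v : V) (e : E) : K := (a e == v)%:R - (b e == v)%:R.
Let bd (e : E) (f : F) : K := (l e == f)%:R - (r e == f)%:R.

Lemma sum_eq_indicator {I : finType} (x : I -> K) (i0 : I) :
  \sum_i x i * (i0 == i)%:R = x i0.
Proof.
rewrite (bigD1 i0) //= eqxx mulr1 big1 ?addr0 // => i /negPf.
by rewrite eq_sym => ->; rewrite mulr0.
Qed.

Hypothesis connV :
  forall x : V -> K, (forall e, x (a e) = x (b e)) -> forall u v, x u = x v.
Hypothesis connF :
  forall x : F -> K, (forall e, x (l e) = x (r e)) -> forall u v, x u = x v.
Hypothesis ortho : forall (x : V -> K) (f : F),
  \sum_e (x (a e) - x (b e)) * bd e f = 0.
Hypothesis euler : (#|V| + #|F| = #|E| + 2)%N.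

(** Dimension count: by [ortho] the row space of [delta] lies in the left kernel of [bd], and
    connectivity of graph and dual together with Euler's formula leaves no room for a strict
    inclusion. *)
Lemma cycle_is_cut (y : E -> K) :
  (forall f, \sum_e y e * bd e f = 0) ->
  exists x : V -> K, forall e, y e = x (a e) - x (b e).
Proof.
move=> y0.
have deltaE (x : V -> K) e : \sum_v x v * delta v e = x (a e) - x (b e).
  rewrite -[x (a e)]sum_eq_indicator -[x (b e)]sum_eq_indicator -sumrB.
  by apply: eq_bigr => v _; rewrite -mulrBr.
have rV : (#|V| <= (\rank (fun_mx delta)).+1)%N.
  apply: card_le_rank_fun_mx => z z0; apply: connV => e.
  by apply/eqP; rewrite -subr_eq0 -deltaE z0.
have rF : (#|F| <= (\rank (fun_mx bd)).+1)%N.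
  rewrite -mxrank_tr.
  have -> : (fun_mx bd)^T = fun_mx (fun f e => bd e f).
    by apply/matrixP=> i j; rewrite !mxE.
  apply: card_le_rank_fun_mx => z z0; apply: connF => e.
  apply/eqP; rewrite -subr_eq0 -[z (l e)]sum_eq_indicator -[z (r e)]sum_eq_indicator.
  rewrite -sumrB; apply/eqP; rewrite -[RHS](z0 e).
  by apply: eq_bigr => f _; rewrite -mulrBr.
have sub : (fun_mx delta <= kermx (fun_mx bd))%MS.
  apply/row_subP=> k; apply/sub_kermxP/mul_fun_mx_eq0 => f.
  rewrite -[RHS](ortho (fun v => (enum_val k == v)%:R) f).
  apply: eq_bigr => e _; rewrite !mxE enum_rankK /delta.
  by rewrite ![enum_val k == _]eq_sym.
(* The kernel has dimension at most [#|E| - #|F| + 1], which Euler's formula turns into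
   [#|V| - 1]. *)
have le : (\rank (kermx (fun_mx bd)) <= \rank (fun_mx delta))%N.
  rewrite mxrank_ker leq_subLR -(leq_add2r 2) -euler !addnS addn0 addnC.
  by rewrite -addSn -addnS leq_add.
have := geq_leqif (mxrank_leqif_sup sub); rewrite le => /esym sup.
pose u : 'rV[K]_#|E| := \row_i y (enum_val i).
have /submx_trans/(_ sup) : (u <= kermx (fun_mx bd))%MS.
  apply/sub_kermxP/mul_fun_mx_eq0 => f; rewrite -[RHS](y0 f).
  by apply: eq_bigr => e _; rewrite mxE enum_rankK.
case/submxP=> w uw; exists (fun v => w 0 (enum_rank v)) => e.
rewrite -(deltaE (fun v => w 0 (enum_rank v))) -row_mul_fun_mx -uw.
by rewrite mxE enum_rankK.
Qed.

Variable W : {set V}.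
(** Connectivity of both sides of the cut, phrased through functions that do not jump along uncut
    edges. *)
Hypothesis bond : forall x : V -> K,
  (forall e, (a e \in W) = (b e \in W) -> x (a e) = x (b e)) ->
  forall u v, (u \in W) = (v \in W) -> x u = x v.

Let A := [set e | (a e \in W) != (b e \in W)].
Let H := [set f | [exists e in A, (l e == f) || (r e == f)]].

(* If there were more cut edges than touched faces, some nonzero [z] supported on
   the cut would satisfy the equations of all touched faces but one, this last
   one being traded for [z e0 = 0].  The traded equation follows from the others,
   because the face equations sum to zero, so [z] is a coboundary of a function
   constant on both sides of the cut, and [z e0 = 0] makes it vanish. *)
Lemma card_bond_le_faces : (#|A| <= #|H|)%N.
Proof.
have [e0 /= e0A|A0] := pickP (mem A); last by rewrite (eq_card0 A0).
rewrite leqNgt; apply/negP=> ltHA.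
have f0H : l e0 \in H by rewrite inE; apply/existsP; exists e0; rewrite e0A eqxx.
pose g e f : K := if f == l e0 then (e0 == e)%:R else bd e f.
have [z [zA [i zi] zH]] := underdetermined_system g ltHA.
have z_e0 : z e0 = 0.
  rewrite -[RHS](zH _ f0H) /g eqxx (bigD1 e0) //= eqxx mulr1 big1 ?addr0 // => e /negPf.
  by rewrite eq_sym => ->; rewrite mulr0.
have z_bd f : f != l e0 -> \sum_e z e * bd e f = 0.
  move=> f_neq; have [fH|fH] := boolP (f \in H).
    by rewrite -[RHS](zH _ fH) /g (negPf f_neq).
  apply: big1 => e _; have [eA|/zA ->] := boolP (e \in A); last by rewrite mul0r.
  move: fH; rewrite inE => /existsPn/(_ e); rewrite eA /= negb_or.
  by case/andP=> /negPf lf /negPf rf; rewrite /bd lf rf subrr mulr0.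
have z_bd0 f : \sum_e z e * bd e f = 0.
  have [->|/z_bd //] := eqVneq f (l e0).
  transitivity (\sum_f \sum_e z e * bd e f).
    by rewrite [RHS](bigD1 (l e0)) //= [X in _ + X]big1 ?addr0.
  rewrite exchange_big big1 // => e _; rewrite -mulr_sumr sumrB.
  have sum1 f1 : \sum_f0 (f1 == f0)%:R = 1 :> K.
    by rewrite -[RHS](sum_eq_indicator (fun=> 1) f1); apply: eq_bigr => ? _; rewrite mul1r.
  by rewrite !sum1 subrr mulr0.
have [x zx] := cycle_is_cut z_bd0.
have xW : forall u v, (u \in W) = (v \in W) -> x u = x v.
  apply: bond => e eW; apply/eqP; rewrite -subr_eq0 -zx; apply/eqP/zA.
  by rewrite inE eW eqxx.
have x_const u v : x u = x v.
  have xe0 : x (a e0) = x (b e0) by apply/eqP; rewrite -subr_eq0 -zx z_e0.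
  have xa w : x w = x (a e0).
    have [|wa] := eqVneq (w \in W) (a e0 \in W); first exact: xW.
    rewrite xe0; apply: xW; move: wa e0A; rewrite /= inE.
    by case: (w \in W); case: (a e0 \in W); case: (b e0 \in W).
  by rewrite xa [RHS]xa.
by move: zi; rewrite zx (x_const _ (b i)) subrr eqxx.
Qed.
End Duality.

(** * Cut darts around a face of a planar map *)

Section FaceCuts.
Variables (V D : finType) (alpha sigma : {perm D}) (vtx : D -> V).
Hypothesis is_mapP : is_map alpha sigma vtx.

Let phi := face_perm alpha sigma.
Let face d := froot phi d.

Lemma alphaK : involutive alpha. Proof. by case: is_mapP. Qed.

Lemma vtx_face_perm d : vtx (phi d) = vtx (alpha d).
Proof.
case: is_mapP => _ _ vtxE; apply/esym/eqP.
by rewrite vtxE /phi /face_perm permM fconnect1.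
Qed.

Lemma face_face_perm d : face (phi d) = face d.
Proof.
apply/eqP; rewrite /face (root_connect (fconnect_sym (@perm_inj _ phi))).
by rewrite fconnect_sym ?fconnect1 //; apply: perm_inj.
Qed.

Lemma sum_face_coboundary {K : fieldType} (x : V -> K) f :
  \sum_d (x (vtx d) - x (vtx (alpha d))) * (face d == f)%:R = 0.
Proof.
under eq_bigr do rewrite mulrBl; rewrite sumrB.
rewrite [X in X - _](reindex_inj (@perm_inj _ phi)) /=.
by under eq_bigr do rewrite vtx_face_perm face_face_perm; rewrite subrr.
Qed.

Lemma cut_alpha W d : (alpha d \in cut alpha vtx W) = (d \in cut alpha vtx W).
Proof. by rewrite !inE alphaK eq_sym. Qed.

(** The jumps of the indicator of [W] sum to zero around a face, whereas a lone cut dart would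
    contribute 1 or -1. *)
Lemma face_cut_card_neq1 W f :
  #|[set d in cut alpha vtx W | face d == f]| != 1%N.
Proof.
apply/negP=> /cards1P[d1 Cd1].
have := sum_face_coboundary (fun v => (v \in W)%:R : rat) f.
have : d1 \in [set d in cut alpha vtx W | face d == f] by rewrite Cd1 set11.
rewrite !inE => /andP[cd1 /eqP fd1].
rewrite (bigD1 d1) //= fd1 eqxx big1 ?addr0 ?mulr1 => [|d dd1].
  by move: cd1; case: (_ \in W); case: (_ \in W).
have : d \notin [set d in cut alpha vtx W | face d == f] by rewrite Cd1 inE.
rewrite !inE negb_and negbK => /orP[/eqP -> | /negPf ->]; last by rewrite mulr0.
by rewrite subrr mul0r.
Qed.

(* [half] is an orientation: one dart from each edge. *)
Let half := [set d | (enum_rank d < enum_rank (alpha d))%N].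
Let E := {d | d \in half}.
Let F := {d | d \in froots phi}.
Let faceF d : F := exist _ (face d) (roots_root (fconnect_sym (@perm_inj _ phi)) d).

Lemma mem_half d : (d \in half) = (alpha d \notin half).
Proof.
rewrite !inE alphaK -leqNgt [RHS]leq_eqVlt.
case: eqP => //= /val_inj/enum_rank_inj ad.
by case: is_mapP => /(_ d); rewrite -ad eqxx.
Qed.

Lemma half_edgeP (P : D -> Prop) :
  (forall d, P d -> P (alpha d)) -> (forall e : E, P (val e)) -> forall d, P d.
Proof.
move=> Pa PE d; have [dE|] := boolP (d \in half); first exact: (PE (Sub d dE)).
rewrite mem_half negbK => dE; rewrite -(alphaK d).
exact: (Pa _ (PE (Sub (alpha d) dE))).
Qed.

Lemma sum_half_edges {M : nmodType} (G : D -> M) :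
  \sum_d G d = \sum_(e : E) (G (val e) + G (alpha (val e))).
Proof.
rewrite (bigID (mem half)) /= [X in _ + X](reindex_inj (@perm_inj _ alpha)) /=.
rewrite [X in _ + X](eq_bigl (mem half)) => [|d]; last by rewrite [RHS]mem_half.
by rewrite -big_split big_sub.
Qed.

Lemma card_darts : #|D| = (2 * #|{: E}|)%N.
Proof.
by rewrite -[LHS]sum1_card (sum_half_edges (fun=> 1%N)) sum_nat_const mulnC.
Qed.

Lemma faceF_eq d (f : F) : (faceF d == f) = (face d == val f).
Proof. by []. Qed.

Lemma faceF_val (f : F) : faceF (val f) = f.
Proof. by apply: val_inj; apply/eqP; case: f. Qed.

Hypothesis connG : connected_graph alpha vtx.
Hypothesis genusP : @genus0 V D alpha sigma.

Lemma connect_invariant (F0 : {set D}) {X : Type} (x : V -> X) :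
  (forall d, d \notin F0 -> x (vtx d) = x (vtx (alpha d))) ->
  forall u v, connect (adj alpha vtx F0) u v -> x u = x v.
Proof.
move=> xE u v /connectP[p]; elim: p u => [|w p IHp] u /=; first by move=> _ ->.
case/andP=> /existsP[d /and3P[dF /eqP <- /eqP <-]] wp vE.
by rewrite xE // (IHp _ wp vE).
Qed.

(** Connectivity of the dual: [y] is also invariant under [sigma], so it is constant on the darts at
    each vertex, and invariance under [alpha] carries the value along paths. *)
Lemma face_connected {X : Type} (y : D -> X) :
  (forall d, y (alpha d) = y d) -> (forall d, y (phi d) = y d) ->
  forall d d', y d = y d'.
Proof.
move=> ya yp d d'.
have ys d1 : y (sigma d1) = y d1.
  by rewrite -(ya d1) -(yp (alpha d1)) /phi /face_perm permM alphaK.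
have yv d1 d2 : vtx d1 = vtx d2 -> y d1 = y d2.
  case: is_mapP => _ _ vtxE /eqP; rewrite vtxE => /iter_findex <-.
  by elim: (findex _ _ _) => //= n ->; rewrite ys.
pose P v := forall d2, vtx d2 = v -> y d2 = y d.
suff: P (vtx d') by move=> /(_ _ erefl).
have /connectP[p] := connG (vtx d) (vtx d').
have : P (vtx d) by move=> d2 /yv.
elim: p (vtx d) => [|w p IHp] v Pv /=; first by move=> _ ->.
case/andP=> /existsP[d1 /and3P[_ /eqP d1v /eqP d1w]]; apply: IHp => d2.
by rewrite -d1w => /yv ->; rewrite ya Pv.
Qed.

(** Double counting of cut darts: there are two per cut edge and at least two per touched face,
    while touched faces are at least as many as cut edges; a third dart on one face would exceed the
    total. *)
Lemma face_cut_card_le2 (W : {set V}) (d0 : D) :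
  (forall u v, (u \in W) = (v \in W) -> connect (adj alpha vtx (cut alpha vtx W)) u v) ->
  (#|[set d in cut alpha vtx W | fconnect phi d0 d]| <= 2)%N.
Proof.
move=> connW; set C := cut alpha vtx W.
pose a (e : E) := vtx (val e); pose b (e : E) := vtx (alpha (val e)).
pose l (e : E) := faceF (val e); pose r (e : E) := faceF (alpha (val e)).
have := @card_bond_le_faces rat V E F a b l r _ _ _ _ W.
set A := [set e | _]; set H := [set f | _] => leAH.
have {leAH} : (#|A| <= #|H|)%N.
  (* In order: connectivity of the graph, connectivity of the dual, vanishing of coboundaries around
     faces, Euler's formula, connectivity of both sides of the cut. *)
  apply: leAH.
  - move=> x xE u v; apply: connect_invariant (connG u v) => d _.
    by elim/half_edgeP: d => [d|e]; [rewrite alphaK | rewrite (xE e)].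
  - move=> x xE f1 f2; rewrite -(faceF_val f1) -(faceF_val f2).
    apply: (@face_connected _ (fun d => x (faceF d))) => [d|d].
      by elim/half_edgeP: d => [d|e]; [rewrite alphaK | rewrite (xE e)].
    by congr x; apply: val_inj; apply: face_face_perm.
  - move=> x f; rewrite -[RHS](sum_face_coboundary x (val f)) sum_half_edges.
    apply: eq_bigr => e _; rewrite !faceF_eq alphaK mulrBr.
    by congr (_ + _); rewrite -mulNr opprB.
  - have := genusP; rewrite /genus0 card_darts mulKn // => <-; congr (_ + _)%N.
    rewrite card_sig /nfaces /n_comp_mem.
    by apply: eq_card => d; rewrite !inE andbT.
  - move=> x xE u v /connW; apply: connect_invariant => d.
    rewrite inE negbK => /eqP; elim/half_edgeP: d => [d IHd|e]; last exact: xE.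
    by rewrite alphaK => /esym /IHd.
have cardC : (#|C| = 2 * #|A|)%N.
  rewrite -sum1_card big_mkcond (sum_half_edges (fun d => (d \in C : nat))) /=.
  rewrite -[#|A|]sum1_card [in RHS]big_mkcond big_distrr /=; apply: eq_bigr => e _.
  by rewrite cut_alpha !inE; case: (_ != _).
pose deg (f : F) := #|[set d in C | face d == val f]|.
have sum_deg : (\sum_f deg f = #|C|)%N.
  rewrite -sum1_card (partition_big faceF predT) //=; apply: eq_bigr => f _.
  by rewrite /deg -sum1_card; apply: eq_bigl => d; rewrite inE.
have deg_ge2 f : f \in H -> (2 <= deg f)%N.
  rewrite inE => /existsP[e /andP[]]; rewrite inE => eA ef.
  have : (0 < deg f)%N.
    apply/card_gt0P; case/orP: ef => ef; [exists (val e) | exists (alpha (val e))].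
      by rewrite inE -faceF_eq ef inE eA.
    by rewrite inE -faceF_eq ef cut_alpha inE eA.
  by have := face_cut_card_neq1 W (val f); rewrite -/(deg f); case: (deg f) => [|[]].
move=> leAH; rewrite leqNgt; apply/negP => gt2.
have {gt2} : (2 < deg (faceF d0))%N.
  apply: leq_trans gt2 _; apply: subset_leq_card; apply/subsetP=> d.
  rewrite !inE => /andP[-> /=]; rewrite fconnect_sym; last exact: perm_inj.
  by rewrite -(root_connect (fconnect_sym (@perm_inj _ phi))).
set f0 := faceF d0 => gt2.
have f0H : f0 \in H.
  have /card_gt0P[d] : (0 < deg f0)%N by apply: leq_trans gt2.
  rewrite !inE => /andP[dC df0]; apply/existsP.
  have [dh|] := boolP (d \in half).
    by exists (Sub d dh); apply/andP; split; [rewrite inE | apply/orP; left].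
  rewrite mem_half negbK => dh; exists (Sub (alpha d) dh); apply/andP; split.
    by rewrite inE /a /b /= alphaK eq_sym.
  by apply/orP; right; rewrite /r /= alphaK.
(* [f0] contributes at least three and every other face of [H] at least two, which exceeds
   [2 * #|H|]. *)
have : (2 * #|A| < #|C|)%N; last by rewrite cardC ltnn.
rewrite -sum_deg (bigID (mem H)) /= (bigD1 f0) //=.
apply: leq_trans (leq_addr _ _).
apply: (@leq_ltn_trans (2 + \sum_(f in H | f != f0) 2)%N).
  rewrite -(bigD1 f0 (F := fun=> 2%N)) //= sum_nat_const mulnC.
  by rewrite leq_mul2r.
by rewrite -addSn; apply: leq_add => //; apply: leq_sum => f /andP[/deg_ge2].
Qed.
End FaceCuts.

(** * Boolean sequences with few changes *)

Lemma change_between (s : nat -> bool) i j :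
  (i < j)%N -> s i != s j -> exists2 k, (i <= k < j)%N & s k != s k.+1.
Proof.
elim: j => [|j IHj]; first by rewrite ltn0.
rewrite ltnS leq_eqVlt => /predU1P[<-|ij] sij.
  by exists i; rewrite ?leqnn ?ltnSn.
have [sjj|sjj] := eqVneq (s j) (s j.+1); last by exists j; rewrite ?ltnSn ?(ltnW ij).
have [|k /andP[ik kj] sk] := IHj ij; first by rewrite sjj.
by exists k; rewrite ?ik ?(leqW kj).
Qed.

(* Starting from the first element, [p] is where the value first changes and [q]
   where it changes back, [b'] recording that it never does; the constant case is
   [b' = false, p = q]. *)
Lemma interval_code {I : finType} (Ti : {set I}) (o : I -> nat) (s : nat -> bool) :
  Ti != set0 ->
  (forall t0 t1 t2 t3, t0 \in Ti -> t1 \in Ti -> t2 \in Ti -> t3 \in Ti ->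
     (o t0 < o t1)%N -> (o t1 < o t2)%N -> (o t2 < o t3)%N ->
     s (o t0) != s (o t1) -> s (o t1) != s (o t2) -> s (o t2) = s (o t3)) ->
  exists b b' p q, [/\ p \in Ti, q \in Ti & forall t, t \in Ti ->
    s (o t) = b (+) ((o p <= o t) && (b' || (o t < o q)))%N].
Proof.
case/set0Pn=> t Tt alt.
case: (@arg_minnP _ t (mem Ti) o Tt) => t0 T0 min0.
have [p0 /andP[/= Tp0 sp0]|sC] :=
    pickP (fun t => (t \in Ti) && (s (o t) != s (o t0))); last first.
  exists (s (o t0)), false, t0, t0; split=> // t1 Tt1.
  rewrite ltnNge andbN addbF; apply/eqP; have := sC t1.
  by rewrite Tt1 => /negbFE.
have P0 : (p0 \in Ti) && (s (o p0) != s (o t0)) by rewrite Tp0.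
case: (@arg_minnP _ p0 (fun t => (t \in Ti) && (s (o t) != s (o t0))) o P0).
move=> p /andP[Tp sp] minp.
have before_p t1 : t1 \in Ti -> (o t1 < o p)%N -> s (o t1) = s (o t0).
  move=> Tt1; rewrite ltnNge => /negP lt; apply/eqP/negPn/negP => st1.
  by apply/lt/minp; rewrite Tt1.
have t0p : (o t0 < o p)%N.
  rewrite ltn_neqAle (min0 _ Tp) andbT; apply: contraNneq sp => ->; exact: eqxx.
have [q0 /and3P[Tq0 pq0 sq0]|qC] :=
    pickP (fun t => [&& t \in Ti, (o p < o t)%N & s (o t) == s (o t0)]); last first.
  exists (s (o t0)), true, p, p; split=> // t1 Tt1; rewrite andbT.
  have [pt1|/(before_p _ Tt1) ->] := leqP (o p) (o t1); last by rewrite addbF.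
  have st1 : s (o t1) != s (o t0).
    have := qC t1; rewrite Tt1 /=; move: pt1; rewrite leq_eqVlt.
    by case/predU1P=> [<- _ // | -> /negbT].
  by move: st1; case: (s (o t1)); case: (s (o t0)).
have Q0 : [&& q0 \in Ti, (o p < o q0)%N & s (o q0) == s (o t0)] by rewrite Tq0 pq0.
case: (@arg_minnP _ q0
  (fun t => [&& t \in Ti, (o p < o t)%N & s (o t) == s (o t0)]) o Q0).
move=> q /and3P[Tq pq /eqP sq] minq.
exists (s (o t0)), false, p, q; split=> // t1 Tt1.
have [pt1|/(before_p _ Tt1) ->] := leqP (o p) (o t1); last by rewrite addbF.
have [t1q|] /= := ltnP (o t1) (o q).
  have st1 : s (o t1) != s (o t0).
    move: pt1; rewrite leq_eqVlt => /predU1P[<- //|pt1].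
    by apply: contraL t1q => st1; rewrite -leqNgt minq // Tt1 pt1.
  by move: st1; case: (s (o t1)); case: (s (o t0)).
rewrite addbF leq_eqVlt => /predU1P[<- //|qt1]; rewrite -sq; apply/esym.
(* The value has already changed from [t0] to [p] and from [p] to [q], so [alt] forbids a change
   after [q]. *)
by apply: (alt t0 p q t1) => //; rewrite ?sq // eq_sym.
Qed.

(** * Cuts leaving two components *)

Lemma cutC (V D : finType) (alpha : {perm D}) (vtx : D -> V) (W : {set V}) :
  cut alpha vtx (~: W) = cut alpha vtx W.
Proof. by apply/setP=> d; rewrite !inE; case: (_ \in W); case: (_ \in W). Qed.

(** Every component stays on one side of the cut. Two components on the same side, plus one on the
    other, would make three. *)
Lemma two_comp_cut_connected (V D : finType) (alpha : {perm D}) (vtx : D -> V)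
    (W : {set V}) :
  involutive alpha -> W != set0 -> W != setT ->
  ncomp alpha vtx (cut alpha vtx W) = 2%N ->
  forall u v, (u \in W) = (v \in W) -> connect (adj alpha vtx (cut alpha vtx W)) u v.
Proof.
move=> aK W0 WT; set e := adj _ _ _; rewrite /ncomp -/e => n2.
have adjW u v : e u v -> (u \in W) = (v \in W).
  case/existsP=> d /and3P[dW /eqP <- /eqP <-].
  by move: dW; rewrite inE negbK => /eqP.
have e_sym : connect_sym e.
  have sub u v : e u v -> e v u.
    case/existsP=> d /and3P[dW du dv]; apply/existsP; exists (alpha d).
    by move: dW; rewrite aK du dv !inE aK eq_sym => ->.
  by apply: sym_connect_sym => u v; apply/idP/idP; apply: sub.
have connW u v : connect e u v -> (u \in W) = (v \in W).
  case/connectP=> p; elim: p u => [|w p IHp] u /=; first by move=> _ ->.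
  by case/andP=> /adjW -> /IHp; apply.
have other u : exists v, (u \in W) != (v \in W).
  have [uW|uW] := boolP (u \in W).
    have : ~: W != set0 by apply: contraNneq WT => W'0; rewrite -(setCK W) W'0 setC0.
    by case/set0Pn=> v; rewrite inE => vW; exists v; rewrite (negPf vW).
  by case/set0Pn: W0 => v vW; exists v; rewrite vW.
move=> u v uv; rewrite -(root_connect e_sym); apply/negPn/negP=> ruv.
have [x ux] := other u.
suff : (3 <= n_comp e predT)%N by rewrite n2.
rewrite /n_comp_mem -[3%N]/(size [:: fingraph.root e u; fingraph.root e v; fingraph.root e x]).
rewrite cardE; apply: uniq_leq_size.
  rewrite /= !inE negb_or ruv !(root_connect e_sym) andbT /=.
  apply/andP; split; apply: contra ux => /connW <-; rewrite ?uv ?eqxx //.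
by move=> y; rewrite !inE mem_enum !inE andbT => /or3P[] /eqP ->; apply: roots_root.
Qed.

(** * Encoding the terminals of a face, and counting *)

Section Encoding.
Variables (V D : finType) (alpha sigma : {perm D}) (vtx : D -> V).
Hypothesis is_mapP : is_map alpha sigma vtx.
Hypothesis connG : connected_graph alpha vtx.
Hypothesis genusP : @genus0 V D alpha sigma.

(** A boundary walk may visit a vertex several times; its first visit is taken as its position. *)
Definition face_pos (d0 : D) (t : V) : nat :=
  index t (map vtx (fingraph.orbit (face_perm alpha sigma) d0)).

Lemma face_posP d0 t : t \in face_verts alpha sigma vtx d0 ->
  (face_pos d0 t < fingraph.order (face_perm alpha sigma) d0)%N /\
  vtx (iter (face_pos d0 t) (face_perm alpha sigma) d0) = t.
Proof.
case/imsetP=> d d0d tE; set phi := face_perm _ _.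
have t_in : t \in map vtx (fingraph.orbit phi d0).
  by rewrite tE map_f // -fconnect_orbit.
have lt : (face_pos d0 t < fingraph.order phi d0)%N.
  by rewrite -(size_orbit phi d0) -(size_map vtx) index_mem.
split=> //; rewrite -[RHS](nth_index t t_in) (nth_map d0) ?size_orbit //.
by rewrite /fingraph.orbit nth_traject.
Qed.

(** Three changes of membership in [W] along the terminals would force three distinct cut darts on a
    single face. *)
Lemma face_interval_code (W : {set V}) (d0 : D) (Ti : {set V}) :
  (forall u v, (u \in W) = (v \in W) -> connect (adj alpha vtx (cut alpha vtx W)) u v) ->
  Ti != set0 -> Ti \subset face_verts alpha sigma vtx d0 ->
  exists b b' p q, [/\ p \in Ti, q \in Ti & forall t, t \in Ti -> (t \in W) =
    b (+) ((face_pos d0 p <= face_pos d0 t) &&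
           (b' || (face_pos d0 t < face_pos d0 q)))%N].
Proof.
move=> connW Ti0 /subsetP TiF; set phi := face_perm alpha sigma.
pose s j := vtx (iter j phi d0) \in W.
have sE t : t \in Ti -> s (face_pos d0 t) = (t \in W).
  by move=> /TiF/face_posP[_ tE]; rewrite /s tE.
have [|b [b' [p [q [Tp Tq bE]]]]] := @interval_code _ Ti (face_pos d0) s Ti0; last first.
  by exists b, b', p, q; split=> // t Tt; rewrite -sE ?bE.
move=> t0 t1 t2 t3 T0 T1 T2 T3 o01 o12 o23 s01 s12; apply/eqP/negPn/negP=> s23.
have [i /andP[_ ilt] si] := change_between o01 s01.
have [j /andP[jge jlt] sj] := change_between o12 s12.
have [k /andP[kge klt] sk] := change_between o23 s23.
have ij : (i < j)%N := leq_trans ilt jge.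
have jk : (j < k)%N := leq_trans jlt kge.
have kord : (k < fingraph.order phi d0)%N.
  by apply: ltn_trans klt _; case: (face_posP (TiF _ T3)).
have := face_cut_card_le2 is_mapP connG genusP d0 connW; rewrite leqNgt => /negP[].
pose js := [:: i; j; k].
rewrite -[3%N]/(size [seq iter n phi d0 | n <- js]) cardE; apply: uniq_leq_size.
  rewrite map_inj_in_uniq => [|m n mjs njs /(congr1 (findex phi d0))].
    by rewrite /= !inE negb_or !neq_ltn ij jk (ltn_trans ij jk).
  have ltj n' : n' \in js -> (n' < fingraph.order phi d0)%N.
    have jord := ltn_trans jk kord.
    by rewrite !inE => /or3P[] /eqP -> //; apply: ltn_trans jord.
  by rewrite !findex_iter ?ltj.
move=> d /mapP[n njs ->]; rewrite mem_enum !inE fconnect_iter andbT.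
(* The head of a dart is the tail of the next one on the face, so a change between [n] and [n.+1]
   says that the [n]-th dart is cut. *)
rewrite -(vtx_face_perm is_mapP) -iterS -/phi -/(s n) -/(s n.+1).
by move: njs; rewrite !inE => /or3P[] /eqP ->.
Qed.

End Encoding.

(** A side [W] of the minimum cut is neither empty nor full since [S] and [T :\: S] are nonempty; if
    it meets [T] in [T :\: S], its complement, which has the same cut, is taken instead. *)
Lemma Te_bond (R : realFieldType) (V D : finType) (alpha : {perm D})
    (vtx : D -> V) (c : D -> R) (T S : {set V}) :
  involutive alpha -> S \in Te alpha vtx c T ->
  exists2 W : {set V}, S = T :&: W & forall u v, (u \in W) = (v \in W) ->
    connect (adj alpha vtx (cut alpha vtx W)) u v.
Proof.
move=> aK; rewrite inE => /and4P[ST S0 SneT /existsP[F0 /andP[/andP[]]]].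
case/existsP=> W /andP[sepW /eqP ->] _ /eqP n2.
have SI : T :&: S = S by apply/setIidPr.
have D0 : T :\: S != set0.
  by rewrite setD_eq0; apply: contra SneT => TS; rewrite eqEsubset ST.
have DT : T :\: S != T.
  apply: contra S0 => /eqP TS.
  by rewrite -SI -{1}TS setDE -setIA [_ :&: S]setIC setICr setI0.
have W0 : W != set0.
  apply: contraTneq sepW => ->.
  by rewrite /separates set0I !(eq_sym set0) negb_or S0 D0.
have WT : W != setT.
  apply: contraTneq sepW => ->.
  by rewrite /separates setTI !(eq_sym T) negb_or SneT DT.
have connW := two_comp_cut_connected aK W0 WT n2.
case/orP: sepW => /eqP WS; first by exists W => //; rewrite setIC.
exists (~: W).
  apply/setP=> t; move/setP/(_ t): WS; move/setP/(_ t): SI; rewrite !inE.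
  by case: (t \in S); case: (t \in T); case: (t \in W).
move=> u v; rewrite cutC !inE => uv; apply: connW.
by move: uv; do 2!case: (_ \in W).
Qed.

(** Each [S] is decoded from one code per face, made of two bits and two terminals of that face, so
    the number of code families bounds the number of sets. *)
Lemma card_Te_le (R : realFieldType) (V D : finType) (alpha sigma : {perm D})
    (vtx : D -> V) (c : D -> R) (T : {set V}) (gamma : nat) (f : 'I_gamma -> D)
    (part : V -> 'I_gamma) :
  is_map alpha sigma vtx -> connected_graph alpha vtx -> @genus0 V D alpha sigma ->
  (forall t, t \in T -> t \in face_verts alpha sigma vtx (f (part t))) ->
  (forall i, [set t in T | part t == i] != set0) ->
  (#|Te alpha vtx c T| <=
     \prod_(i < gamma) (4 * #|[set t in T | part t == i]| ^ 2))%N.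
Proof.
move=> is_mapP connG genusP partP; set Ti := fun i => [set t in T | part t == i] => Ti0.
have aK := alphaK is_mapP.
pose code := (bool * bool * (V * V))%type.
pose bit (i : 'I_gamma) (x : code) t :=
  let o := face_pos alpha sigma vtx (f i) in
  x.1.1 (+) ((o x.2.1 <= o t) && (x.1.2 || (o t < o x.2.2)))%N.
pose codes i : {set code} := setX setT (setX (Ti i) (Ti i)).
pose decode (x : {ffun 'I_gamma -> code}) := [set t in T | bit (part t) (x (part t)) t].
have sub : Te alpha vtx c T \subset decode @: family (fun i => mem (codes i)).
  apply/subsetP=> S /(Te_bond aK)[W -> connW].
  have /fin_all_exists[x xP] i : exists x : code, x \in codes i /\
      forall t, t \in Ti i -> (t \in W) = bit i x t.
    have TiF : Ti i \subset face_verts alpha sigma vtx (f i).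
      by apply/subsetP=> t; rewrite inE => /andP[/partP tF /eqP <-].
    have [b [b' [p [q [Tp Tq bE]]]]] :=
      face_interval_code is_mapP connG genusP connW (Ti0 i) TiF.
    by exists (b, b', (p, q)); rewrite !in_setX Tp Tq inE.
  apply/imsetP; exists (finfun x).
    by apply/familyP=> i; rewrite ffunE; case: (xP i).
  apply/setP=> t; rewrite in_setI in_set; case: (boolP (t \in T)) => //= tT.
  by rewrite ffunE; case: (xP (part t)) => _; apply; rewrite inE tT /=.
apply: leq_trans (subset_leq_card sub) (leq_trans (leq_imset_card _ _) _).
rewrite card_family foldrE big_map big_enum /=; apply: leq_prod => i _.
by rewrite !cardsX cardsT !card_prod card_bool mulnn.
Qed.

Theorem theorem4p4 (R : realFieldType) (V D : finType) (alpha sigma : {perm D})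
  (vtx : D -> V) (c : D -> R) (T : {set V})
  (gamma : nat) (f : 'I_gamma -> D) (part : V -> 'I_gamma) :
  is_map alpha sigma vtx ->
  connected_graph alpha vtx ->
  @genus0 V D alpha sigma ->
  weights_ok alpha c ->
  unique_min_cuts alpha vtx c T ->
  (* f_1..f_gamma cover T and gamma = gamma(G) is the minimum such number *)
  covers alpha sigma vtx T f ->
  (forall (m : nat) (g : 'I_m -> D), covers alpha sigma vtx T g -> (gamma <= m)%N) ->
  (* T_i = part^-1(i) /\ T, every terminal of T_i lies on the boundary of f_i *)
  (forall t, t \in T -> t \in face_verts alpha sigma vtx (f (part t))) ->
  let k := fun i : 'I_gamma => #|[set t in T | part t == i]| in
  ((#|Te alpha vtx c T|)%:R
      <= 2%:R ^+ (2 * gamma) * \prod_(i < gamma) ((k i)%:R ^+ 2) :> R)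
  /\ (2%:R ^+ (2 * gamma) * \prod_(i < gamma) ((k i)%:R ^+ 2)
      <= (2%:R * (#|T|)%:R / gamma%:R) ^+ (2 * gamma) :> R).
Proof.
move=> is_mapP connG genusP _ _ _ min_gamma partP k.
have Ti0 i : [set t in T | part t == i] != set0.
  (* If T_i were empty, the other gamma - 1 faces would already cover T. *)
  case: gamma f part min_gamma partP k i => [|m] f part min_gamma partP k i.
    by case: i.
  apply/negP=> /eqP Ti0.
  have /min_gamma : covers alpha sigma vtx T (fun j => f (lift i j)).
    move=> t tT; have : i != part t.
      apply: contra_eq_neq Ti0 => it; apply/set0Pn; exists t.
      by rewrite inE tT it eqxx.
    by case/unlift_some=> j jE _; exists j; rewrite -jE partP.
  by rewrite ltnn.
have sum_k : (\sum_i k i = #|T|)%N.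
  rewrite -sum1_card (partition_big part predT) //=; apply: eq_bigr => i _.
  by rewrite /k -sum1_card; apply: eq_bigl => t; rewrite inE.
split.
  apply: le_trans (_ : (\prod_(i < gamma) (4 * k i ^ 2))%:R <= _).
    by rewrite ler_nat; apply: card_Te_le is_mapP connG genusP partP Ti0.
  rewrite big_split /= prod_nat_const card_ord natrM natr_prod natrX exprM -(natrX _ 2 2).
  by under eq_bigr do rewrite natrX.
(* The powers of two cancel and both sides become squares, leaving AM-GM for the [k i], whose sum is
   [#|T|]. *)
rewrite -mulrA exprMn ler_pM2l ?exprn_gt0 ?ltr0n // mulnC exprM prodrXl.
apply: lerXn2r; rewrite ?nnegrE ?prodr_ge0 ?exprn_ge0 ?divr_ge0 ?ler0n //.
have [+ _] := @leif_AGM R 'I_gamma predT (fun i => (k i)%:R) (fun i _ => ler0n _ _).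
by rewrite card_ord -natr_sum sum_k.
Qed.
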